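(* Let $(w^l)_{l\ge0}$ be the sequence produced by the policy iteration algorithm described in the context. The following assertions hold: 1. For all $l\in\mathbb{N}$, $F^{\mathcal{R}}(w^l)\le w^l$. 2. The sequence $(w^l)_{l\ge0}$ is decreasing (i.e. $w^{l}\le w^{l-1}$ for all $l\ge1$). Moreover, for all $l\ge1$ such that $w^{l-1}\in\mathcal{S}$, either $w^l=w^{l-1}$ and $F^{\mathcal{R}}(w^l)=w^l$, or $w^l<w^{l-1}$. 3. For all $l\in\mathbb{N}$ and all $k\in[d+1]$, $X_k^0\le w_k^l\le w_k^0$. 4. The limit $w^\infty$ of $(w^l)_{l\ge0}$ satisfies $F^{\mathcal{R}}(w^\infty)\le w^\infty$. Moreover, if $w^k\in\mathcal{S}$ for all $k\in\mathbb{N}$, then $F^{\mathcal{R}}(w^\infty)=w^\infty$.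
   Context: $[n]=\{1,\dots,n\}$. For vectors $y,z$ of the same dimension $n$, $y\le z$ means $y_l\le z_l$ for all $l\in[n]$, and $y<z$ means $y_l<z_l$ for all $l\in[n]$. For matrices, $A\succeq0$ means symmetric positive semidefinite, and $Y\ge0$ means symmetric with nonnegative entries. Suprema and infima are taken in $[-\infty,+\infty]$, with $\sup\emptyset=-\infty$, $\inf\emptyset=+\infty$. $\mathbb{S}_n$: real symmetric $n\times n$ matrices; $\mathbb{M}_{n\times m}$: real $n\times m$ matrices; $\mathbb{S}_n^{\ge0}$: matrices in $\mathbb{S}_n$ with nonnegative entries; $\mathbb{S}_n^+$: positive semidefinite matrices in $\mathbb{S}_n$. **Piecewise affine system.** $P=(X^0,\mathcal{X},\mathcal{A})$, where $\mathcal{X}=\{X^i, i\in\mathcal{I}\}$ ($\mathcal{I}$ finite) is a family of convex polyhedra with $\bigcup_{i}X^i=\mathbb{R}^d$ and $X^i\cap X^j=\emptyset$ for $i\ne j$; $\mathcal{A}=\{f^i: x\mapsto A^ix+b^i,\ i\in\mathcal{I}\}$ with $A^i\in\mathbb{M}_{d\times d}$, $b^i\in\mathbb{R}^d$; $X^0$ is a nonempty polytope. Each $X^i$ ($i\in\mathcal{I}$) and $X^0$ (index $0$) has the form $\{x\mid T^i_sx<c^i_s,\ T^i_wx\le c^i_w\}$, where $T^i\in\mathbb{M}_{n_i\times d}$, $c^i\in\mathbb{R}^{n_i}$ collect all strict and weak rows. $X^{ij}=X^i\cap(f^i)^{-1}(X^j)$, $X^{i0}=X^i\cap X^0$, $\overline{\mathrm{Sw}}=\{(i,j)\in\mathcal{I}^2\mid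 X^{ij}\ne\emptyset\}$, $\mathrm{In}=\{i\in\mathcal{I}\mid X^{i0}\neq\emptyset\}$. **Matrices.** $F^i=\begin{pmatrix}1&0\\ b^i&A^i\end{pmatrix}$; $\mathbf{M}(A,b,c)=\begin{pmatrix}c&(b/2)^\intercal\\ b/2&A\end{pmatrix}$; $\overline{\mathbf{H}(T,c)}=\begin{pmatrix}1&0\\ c&-T\end{pmatrix}$; $E^i=\overline{\mathbf{H}(T^i,c^i)}$, $E^{ij}=\overline{\mathbf{H}\left(\begin{pmatrix}T^i\\ T^jA^i\end{pmatrix},\begin{pmatrix}c^i\\ c^j-T^jb^i\end{pmatrix}\right)}$, $E^{i0}=\overline{\mathbf{H}\left(\begin{pmatrix}T^i\\ T^0\end{pmatrix},\begin{pmatrix}c^i\\ c^0\end{pmatrix}\right)}$; $n_{ij}$ and $n_{i0}$ are the numbers of rows of $E^{ij}$ and $E^{i0}$. **Problem (PSD).** Minimize $\alpha+\beta$ over reals $\alpha\ge0,\beta\ge0$ and families $\mathcal{P}=\{(P^i,q^i)\in\mathbb{S}_d\times\mathbb{R}^d\}_{i\in\mathcal{I}}$, $\mathcal{W}=\{(W^i_p,W^i_+)\in\mathbb{S}^{\ge0}_{n_i+1}\times\mathbb{S}^+_{n_i+1}\}_{i\in\mathcal{I}}$, $\mathcal{U}=\{(U^{ij}_p,U^{ij}_+)\in\mathbb{S}^{\ge0}_{n_{ij}}\times\mathbb{S}^+_{n_{ij}}\}_{(i,j)\in\overline{\mathrm{Sw}}}$, $\mathcal{Z}=\{(Z^{i0}_p,Z^{i0}_+)\in\mathbb{S}^{\ge0}_{n_{i0}}\times\mathbb{S}^+_{n_{i0}}\}_{i\in\mathrm{In}}$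 such that (a) $\forall i\in\mathcal{I}$: $\mathbf{M}(P^i,2q^i,-\alpha)-\mathbf{M}(\mathrm{Id},0,-\beta)-{E^i}^\intercal(W^i_p+W^i_+)E^i\succeq0$; (b) $\forall(i,j)\in\overline{\mathrm{Sw}}$: $\mathbf{M}(P^i,2q^i,0)-{F^i}^\intercal\mathbf{M}(P^j,2q^j,0)F^i-{E^{ij}}^\intercal(U^{ij}_p+U^{ij}_+)E^{ij}\succeq0$; (c) $\forall i\in\mathrm{In}$: $-\mathbf{M}(P^i,2q^i,-\alpha)-{E^{i0}}^\intercal(Z^{i0}_p+Z^{i0}_+)E^{i0}\succeq0$. **Standing assumption.** Problem (PSD) has an optimal solution $(\mathcal{P},\mathcal{W},\mathcal{U},\mathcal{Z},\alpha,\beta)$ with $\alpha>0$, which is fixed; $L^i(x)=x^\intercal P^ix+2x^\intercal q^i$ and $L(x)=L^i(x)$ for $x\in X^i$. **Relaxed functional.** $X_k^0=\sup_{y\in X^0}y_k^2$ for $k\in[d]$, $X_{d+1}^0=\sup_{y\in X^0}L(y)$. Let $\mathbf{M}_k$ be the matrix $\mathbf{M}$ of the quadratic form $x\mapsto x_k^2$, $\mathbf{M}_L^i=\mathbf{M}(P^i,2q^i,0)$, and let $\mathbf{N}\in\mathbb{M}_{(d+1)\times(d+1)}$ have $\mathbf{N}_{1,1}=1$ and all other entries $0$. For $\lambda\in\mathbb{R}_+^{d+1}$, $Y\in\mathbb{S}^{\ge0}_{n_{ij}}$, $Z\in\mathbb{S}^+_{n_{ij}}$: $\Phi_{ij,k}(\lambda,Y,Z)={F^i}^\intercal\mathbf{M}_kF^i-\sum_{m=1}^d\lambda_m\mathbf{M}_m-\lambda_{d+1}\mathbf{M}_L^i+{E^{ij}}^\intercal(Y+Z)E^{ij}$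 for $k\in[d]$, and $\Phi_{ij,d+1}(\lambda,Y,Z)={F^i}^\intercal\mathbf{M}_L^jF^i-\sum_{m=1}^d\lambda_m\mathbf{M}_m-\lambda_{d+1}\mathbf{M}_L^i+{E^{ij}}^\intercal(Y+Z)E^{ij}$. For $\omega\in\mathbb{R}^{d+1}$, $(i,j)\in\overline{\mathrm{Sw}}$ and $l\in[d+1]$: $F^{\mathcal{R}}_{ij,l}(\omega)$ is the infimum of $\eta$ over $\eta\in\mathbb{R}$, $\lambda\in\mathbb{R}_+^{d+1}$, $Y\ge0$, $Z\succeq0$ with $(\eta-\sum_{k=1}^{d+1}\lambda_k\omega_k)\mathbf{N}-\Phi_{ij,l}(\lambda,Y,Z)\succeq0$; $F^{\mathcal{R}}_l(\omega)=\sup\{\sup_{(i,j)\in\overline{\mathrm{Sw}}}F^{\mathcal{R}}_{ij,l}(\omega),X_l^0\}$; $F^{\mathcal{R}}=(F^{\mathcal{R}}_1,\dots,F^{\mathcal{R}}_{d+1})$. **Policies.** For $\lambda\in\mathbb{R}_+^{d+1}$, $F^\lambda_{ij,l}(\omega)=\sum_{m=1}^{d+1}\lambda_m\omega_m+\inf_{Y\ge0,Z\succeq0}\sup_{x\in\mathbb{R}^d}\begin{pmatrix}1\\ x\end{pmatrix}^\intercal\Phi_{ij,l}(\lambda,Y,Z)\begin{pmatrix}1\\ x\end{pmatrix}$. One has $F^{\mathcal{R}}_{ij,l}=\inf_{\lambda\in\mathbb{R}_+^{d+1}}F^\lambda_{ij,l}$. Let $\mathrm{Sol}((i,j),l,\omega)=\{\lambda\in\mathbb{R}_+^{d+1}\mid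 F^{\mathcal{R}}_{ij,l}(\omega)=F^\lambda_{ij,l}(\omega)\}$ and $\mathcal{S}=\{\omega\in\mathbb{R}^{d+1}\mid\forall(i,j)\in\overline{\mathrm{Sw}},\forall l\in[d+1],\ \mathrm{Sol}((i,j),l,\omega)\ne\emptyset\}$. A policy $\pi$ chosen at $\omega\in\mathcal{S}$ selects, for each $(i,j)\in\overline{\mathrm{Sw}}$ and $l\in[d+1]$, some $\pi_{ij,l}\in\mathrm{Sol}((i,j),l,\omega)$; then $F^\pi_l(v)=\sup\{\sup_{(i,j)\in\overline{\mathrm{Sw}}}F^{\pi_{ij,l}}_{ij,l}(v),X_l^0\}$ and $F^\pi=(F_1^\pi,\dots,F^\pi_{d+1})$. **Algorithm.** $w^0_k=\beta$ for $k\in[d]$ and $w^0_{d+1}=\alpha$. For $l\ge1$: if $w^{l-1}\in\mathcal{S}$ and $F^{\mathcal{R}}(w^{l-1})\ne w^{l-1}$, choose a policy $\pi^l$ at $w^{l-1}$ (so that $F^{\mathcal{R}}(w^{l-1})=F^{\pi^l}(w^{l-1})$) and let $w^l$ be the smallest fixed point of $F^{\pi^l}$ in $\mathbb{R}^{d+1}$, computed as the solution of the linear program $\min\{\sum_{k=1}^{d+1}v_k\mid F^{\pi^l}(v)\le v\}$, i.e. the smallest element of $\{v\in\mathbb{R}^{d+1}\mid F^{\pi^l}(v)\le v\}$. Otherwise the algorithm has stopped and $w^l=w^{l-1}$.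
   Formalization: In assertion 2, w^l < w^{l-1} is read as w^l ≤ w^{l-1} and w^l ≠ w^{l-1}, not strict in every coordinate; the latter fails, e.g. d=2, one region R^2, f(x)=x/2, X^0=[-1,1]^2, where w^0=(2,2,2) and w^1=(1,1,2). *)

(* Defs.v *)
From HB Require Import structures.
From mathcomp Require Import all_boot all_order all_algebra.
From mathcomp Require Import all_classical all_reals all_analysis.

Set Implicit Arguments.
Unset Strict Implicit.
Unset Printing Implicit Defensive.

Import Order.TTheory GRing.Theory Num.Theory.
Import numFieldNormedType.Exports.
Local Open Scope classical_set_scope.
Local Open Scope ring_scope.

Definition le_vec (disp : Order.disp_t) (T : porderType disp) (n : nat)
    (y z : 'cV[T]_n) : Prop :=
  forall l, (y l 0%R <= z l 0%R)%O.

(** The strict part of the order [le_vec]. Strictness in every coordinate would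
    be too strong for the iterates below: the bounds [X0bound <= w l <= w 0]
    freeze each coordinate where [X0bound] and [w 0] agree, and this does
    happen while other coordinates decrease. *)
Definition lt_vec (disp : Order.disp_t) (T : porderType disp) (n : nat)
    (y z : 'cV[T]_n) : Prop :=
  le_vec y z /\ y <> z.

Definition vecE (R : realType) (n : nat) (v : 'cV[R]_n) : 'cV[\bar R]_n :=
  map_mx EFin v.

Definition psdmx (R : realType) (n : nat) (A : 'M[R]_n) : Prop :=
  A \is symmetricmx /\ forall x : 'cV[R]_n, 0 <= (x^T *m A *m x) 0 0.

Definition nonnegmx (R : realType) (n : nat) (A : 'M[R]_n) : Prop :=
  A \is symmetricmx /\ forall i j, 0 <= A i j.

(** The matrix of [x |-> x^T A x + b^T x + c] acting on [(1, x)]. *)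
Definition Mmx (R : realType) (d : nat)
    (A : 'M[R]_d) (b : 'cV[R]_d) (c : R) : 'M[R]_(1 + d) :=
  block_mx c%:M (2^-1 *: b)^T (2^-1 *: b) A.

Definition Hbar (R : realType) (n d : nat)
    (T : 'M[R]_(n, d)) (c : 'cV[R]_n) : 'M[R]_(1 + n, 1 + d) :=
  block_mx 1%:M 0 c (- T).

Definition qform (R : realType) (d : nat)
    (Q : 'M[R]_(1 + d)) (x : 'cV[R]_d) : R :=
  ((col_mx 1%:M x)^T *m Q *m col_mx 1%:M x) 0 0.

Record polyhedron (R : realType) (d : nat) := Polyhedron {
  nstrict : nat;
  nweak : nat;
  Tstrict : 'M[R]_(nstrict, d);
  Tweak : 'M[R]_(nweak, d);
  cstrict : 'cV[R]_nstrict;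
  cweak : 'cV[R]_nweak }.

Definition nrows (R : realType) (d : nat) (X : polyhedron R d) : nat :=
  (nstrict X + nweak X)%N.

Definition Tmx (R : realType) (d : nat) (X : polyhedron R d) :
  'M[R]_(nrows X, d) := col_mx (Tstrict X) (Tweak X).

Definition cvec (R : realType) (d : nat) (X : polyhedron R d) :
  'cV[R]_(nrows X) := col_mx (cstrict X) (cweak X).

Definition pset (R : realType) (d : nat) (X : polyhedron R d) :
    set 'cV[R]_d :=
  [set x | (forall s, (Tstrict X *m x) s 0 < cstrict X s 0) /\
           (forall s, (Tweak X *m x) s 0 <= cweak X s 0)].

(** A polytope is a bounded polyhedron; strict rows are allowed. *)
Definition polytope (R : realType) (d : nat) (X : polyhedron R d) : Prop :=
  exists M : R, forall x, pset X x -> forall k, `|x k 0| <= M.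

Record pwa (R : realType) (d : nat) (I : finType) := Pwa {
  region : I -> polyhedron R d;
  init : polyhedron R d;
  Amx : I -> 'M[R]_d;
  bvec : I -> 'cV[R]_d }.

Definition pwa_wf (R : realType) (d : nat) (I : finType) (S : pwa R d I) :
    Prop :=
  [/\ \bigcup_(i in [set: I]) pset (region S i) = setT,
      forall i j, i <> j -> pset (region S i) `&` pset (region S j) = set0,
      pset (init S) !=set0 &
      polytope (init S)].

Section System.
Variables (R : realType) (d : nat) (I : finType) (S : pwa R d I).

Let X (i : I) : polyhedron R d := region S i.
Let X0 : polyhedron R d := init S.

Definition faff (i : I) (x : 'cV[R]_d) : 'cV[R]_d := Amx S i *m x + bvec S i.

Definition Sw (i j : I) : Prop :=
  pset (X i) `&` faff i @^-1` pset (X j) !=set0.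

Definition In (i : I) : Prop := pset (X i) `&` pset X0 !=set0.

Definition Fmx (i : I) : 'M[R]_(1 + d) := block_mx 1%:M 0 (bvec S i) (Amx S i).

Definition ni (i : I) : nat := (1 + nrows (X i))%N.
Definition nij (i j : I) : nat := (1 + (nrows (X i) + nrows (X j)))%N.
Definition ni0 (i : I) : nat := (1 + (nrows (X i) + nrows X0))%N.

Definition Ei (i : I) : 'M[R]_(ni i, 1 + d) := Hbar (Tmx (X i)) (cvec (X i)).

Definition Eij (i j : I) : 'M[R]_(nij i j, 1 + d) :=
  Hbar (col_mx (Tmx (X i)) (Tmx (X j) *m Amx S i))
       (col_mx (cvec (X i)) (cvec (X j) - Tmx (X j) *m bvec S i)).

Definition Ei0 (i : I) : 'M[R]_(ni0 i, 1 + d) :=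
  Hbar (col_mx (Tmx (X i)) (Tmx X0)) (col_mx (cvec (X i)) (cvec X0)).

(** The families indexed by [Sw] and [In] are total functions; their values
    outside these index sets are unconstrained and never used. *)
Record psd_point := PsdPoint {
  alpha : R;
  beta : R;
  Pmx : I -> 'M[R]_d;
  qvec : I -> 'cV[R]_d;
  Wp : forall i, 'M[R]_(ni i);
  Ws : forall i, 'M[R]_(ni i);
  Up : forall i j, 'M[R]_(nij i j);
  Us : forall i j, 'M[R]_(nij i j);
  Zp : forall i, 'M[R]_(ni0 i);
  Zs : forall i, 'M[R]_(ni0 i) }.

Definition psd_feasible (s : psd_point) : Prop :=
  [/\ [/\ 0 <= alpha s, 0 <= beta s & forall i, Pmx s i \is symmetricmx],
      [/\ forall i, nonnegmx (Wp s i) /\ psdmx (Ws s i),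
          forall i j, Sw i j -> nonnegmx (Up s i j) /\ psdmx (Us s i j) &
          forall i, In i -> nonnegmx (Zp s i) /\ psdmx (Zs s i)],
      forall i,
        psdmx (Mmx (Pmx s i) (2 *: qvec s i) (- alpha s)
               - Mmx 1%:M 0 (- beta s)
               - (Ei i)^T *m (Wp s i + Ws s i) *m Ei i),
      forall i j, Sw i j ->
        psdmx (Mmx (Pmx s i) (2 *: qvec s i) 0
               - (Fmx i)^T *m Mmx (Pmx s j) (2 *: qvec s j) 0 *m Fmx i
               - (Eij i j)^T *m (Up s i j + Us s i j) *m Eij i j) &
      forall i, In i ->
        psdmx (- Mmx (Pmx s i) (2 *: qvec s i) (- alpha s)
               - (Ei0 i)^T *m (Zp s i + Zs s i) *m Ei0 i)].

Definition psd_optimal (s : psd_point) : Prop :=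
  psd_feasible s /\
  forall s', psd_feasible s' -> alpha s + beta s <= alpha s' + beta s'.

Variable s : psd_point.

Definition Lloc (i : I) (x : 'cV[R]_d) : R :=
  (x^T *m Pmx s i *m x) 0 0 + 2 * (x^T *m qvec s i) 0 0.

(** The default value is irrelevant when the regions cover the space; the
    choice of [i] is irrelevant when they are disjoint. *)
Definition L (x : 'cV[R]_d) : R :=
  if [pick i | `[< pset (X i) x >]] is Some i then Lloc i x else 0.

(** Coordinates [1..d] of R^(d+1) are [lshift 1 k]; coordinate [d+1] is
    [rshift d ord0]. *)
Definition X0bound : 'cV[\bar R]_(d + 1) :=
  \col_l match fintype.split l with
         | inl k => ereal_sup [set (y k 0 ^+ 2)%:E | y in pset X0]
         | inr _ => ereal_sup [set (L y)%:E | y in pset X0]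
         end.

Definition Mk (k : 'I_d) : 'M[R]_(1 + d) := Mmx (delta_mx k k) 0 0.

Definition ML (i : I) : 'M[R]_(1 + d) := Mmx (Pmx s i) (2 *: qvec s i) 0.

Definition Nmx : 'M[R]_(1 + d) := block_mx 1%:M 0 0 0.

Definition Phi (i j : I) (l : 'I_(d + 1)) (lam : 'cV[R]_(d + 1))
    (Y Z : 'M[R]_(nij i j)) : 'M[R]_(1 + d) :=
  (Fmx i)^T *m (match fintype.split l with inl k => Mk k | inr _ => ML j end) *m Fmx i
  - \sum_(m < d) lam (lshift 1 m) 0 *: Mk m
  - lam (rshift d ord0) 0 *: ML i
  + (Eij i j)^T *m (Y + Z) *m Eij i j.

Definition FRij (i j : I) (l : 'I_(d + 1)) (omega : 'cV[R]_(d + 1)) : \bar R :=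
  ereal_inf [set eta%:E | eta in
    [set eta : R | exists (lam : 'cV[R]_(d + 1)) (Y Z : 'M[R]_(nij i j)),
      [/\ le_vec 0 lam, nonnegmx Y, psdmx Z &
          psdmx ((eta - \sum_k lam k 0 * omega k 0) *: Nmx
                 - Phi l lam Y Z)]]].

Definition sup_Sw (F : I -> I -> \bar R) : \bar R :=
  ereal_sup [set F ij.1 ij.2 | ij in [set ij | Sw ij.1 ij.2]].

Definition FR (omega : 'cV[R]_(d + 1)) : 'cV[\bar R]_(d + 1) :=
  \col_l maxe (sup_Sw (fun i j => FRij i j l omega)) (X0bound l 0).

Definition Flam (i j : I) (l : 'I_(d + 1)) (lam : 'cV[R]_(d + 1))
    (omega : 'cV[R]_(d + 1)) : \bar R :=
  ((\sum_m lam m 0 * omega m 0)%:E +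
   ereal_inf [set ereal_sup [set (qform (Phi l lam YZ.1 YZ.2) x)%:E
                            | x in [set: 'cV[R]_d]]
             | YZ in [set YZ : 'M[R]_(nij i j) * 'M[R]_(nij i j)
                     | nonnegmx YZ.1 /\ psdmx YZ.2]])%E.

Definition Sol (i j : I) (l : 'I_(d + 1)) (omega : 'cV[R]_(d + 1)) :
    set 'cV[R]_(d + 1) :=
  [set lam | le_vec 0 lam /\ FRij i j l omega = Flam i j l lam omega].

Definition Sset : set 'cV[R]_(d + 1) :=
  [set omega | forall i j, Sw i j -> forall l, Sol i j l omega !=set0].

Definition policy : Type := I -> I -> 'I_(d + 1) -> 'cV[R]_(d + 1).

Definition policy_at (omega : 'cV[R]_(d + 1)) (pi : policy) : Prop :=
  forall i j, Sw i j -> forall l, Sol i j l omega (pi i j l).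

Definition Fpol (pi : policy) (v : 'cV[R]_(d + 1)) : 'cV[\bar R]_(d + 1) :=
  \col_l maxe (sup_Sw (fun i j => Flam i j l (pi i j l) v)) (X0bound l 0).

Definition smallest_fixpoint (F : 'cV[R]_(d + 1) -> 'cV[\bar R]_(d + 1))
    (v : 'cV[R]_(d + 1)) : Prop :=
  F v = vecE v /\ forall u, F u = vecE u -> le_vec v u.

Definition winit : 'cV[R]_(d + 1) :=
  col_mx (const_mx (beta s)) (const_mx (alpha s)).

Definition pi_continues (v : 'cV[R]_(d + 1)) : Prop :=
  Sset v /\ FR v <> vecE v.

(** The choice of policy is not deterministic, so the iterates are described
    by a relation. *)
Definition policy_iteration (w : nat -> 'cV[R]_(d + 1)) : Prop :=
  [/\ w 0%N = winit,
      forall l, pi_continues (w l) ->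
        exists2 pi, policy_at (w l) pi & smallest_fixpoint (Fpol pi) (w l.+1) &
      forall l, ~ pi_continues (w l) -> w l.+1 = w l].

End System.

(* Main.v *)
(** Feasibility of the SDP point gives [X0bound <= winit] and
    [FR winit <= winit]. If [FR w <= w], a policy [pi] at [w] satisfies
    [Fpol pi w = FR w <= w], so by Knaster-Tarski on the box [X0bound, w] the
    smallest fixed point [w'] of [Fpol pi] lies below [w], and
    [FR w' <= Fpol pi w' = w'] because [FRij] is dominated by every [Flam]; this
    last fact rests on a matrix [c N - Q] being positive semidefinite as soon as
    the quadratic function of [Q] is bounded by [c]. The decreasing iterates
    converge, and [FR winf <= winf] by monotonicity. Conversely
    [w (l+1) <= FR (w l)], so [winf <= FR winf] since [FR] is upper
    semicontinuous, being a finite supremum of infima of affine functions. *)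

Require Import Defs.
From HB Require Import structures.
From mathcomp Require Import all_boot all_order all_algebra.
From mathcomp Require Import all_classical all_reals all_analysis.
From mathcomp Require Import ring lra.

Set Implicit Arguments.
Unset Strict Implicit.
Unset Printing Implicit Defensive.

Import Order.TTheory GRing.Theory Num.Theory.
Import numFieldNormedType.Exports.
Local Open Scope classical_set_scope.
Local Open Scope ring_scope.

(** * Quadratic forms, semidefinite matrices and entrywise nonnegative matrices *)

Section Quadratic.
Context {R : realType}.

Lemma symmetricmxP {n : nat} (A : 'M[R]_n) :
  reflect (A^T = A) (A \is symmetricmx).
Proof.
rewrite is_hermitianmxE expr0 scale1r map_mx_id //.
by apply: (iffP eqP) => /esym.
Qed.

Definition quad {n : nat} (Q : 'M[R]_n) (v : 'cV[R]_n) : R :=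
  (v^T *m Q *m v) 0 0.

Lemma quadD {n : nat} (P Q : 'M[R]_n) v : quad (P + Q) v = quad P v + quad Q v.
Proof. by rewrite /quad mulmxDr mulmxDl mxE. Qed.

Lemma quadN {n : nat} (Q : 'M[R]_n) v : quad (- Q) v = - quad Q v.
Proof. by rewrite /quad mulmxN mulNmx mxE. Qed.

Lemma quadZ {n : nat} a (Q : 'M[R]_n) v : quad (a *: Q) v = a * quad Q v.
Proof. by rewrite /quad -scalemxAr -scalemxAl mxE. Qed.

Lemma quadZr {n : nat} a (Q : 'M[R]_n) v : quad Q (a *: v) = a ^+ 2 * quad Q v.
Proof.
rewrite /quad -scalemxAr [(_ *: _)^T]linearZ /= -!scalemxAl scalerA mxE.
by rewrite expr2.
Qed.

Lemma quad_parallelogram {n : nat} (Q : 'M[R]_n) u v :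
  quad Q (u + v) + quad Q (u - v) = 2 * quad Q u + 2 * quad Q v.
Proof.
have trD (x y : 'cV[R]_n) : (x + y)^T = x^T + y^T by exact: linearD.
have trN (x : 'cV[R]_n) : (- x)^T = - x^T by exact: linearN.
rewrite /quad !(trD, trN) !(mulmxDl, mulmxDr, mulmxN, mulNmx).
move: (_ *m u) (_ *m v) (v^T *m Q *m u) (v^T *m Q *m v) => a b c e.
by rewrite !mxE; ring.
Qed.

Lemma quad_congr {m n : nat} (B : 'M[R]_(m, n)) (Q : 'M[R]_m) v :
  quad (B^T *m Q *m B) v = quad Q (B *m v).
Proof. by rewrite /quad trmx_mul !mulmxA. Qed.

Lemma psdmxP {n : nat} (Q : 'M[R]_n) :
  psdmx Q <-> Q^T = Q /\ forall v, 0 <= quad Q v.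
Proof. by split=> -[/symmetricmxP]. Qed.

Lemma psdmxD {n : nat} (P Q : 'M[R]_n) : psdmx P -> psdmx Q -> psdmx (P + Q).
Proof.
move=> /psdmxP[sP pP] /psdmxP[sQ pQ]; apply/psdmxP; split=> [|v].
  by rewrite linearD /= sP sQ.
by rewrite quadD addr_ge0.
Qed.

Lemma trmx_congr {m n : nat} (B : 'M[R]_(m, n)) (Q : 'M[R]_m) :
  Q^T = Q -> (B^T *m Q *m B)^T = B^T *m Q *m B.
Proof. by move=> sQ; rewrite !trmx_mul trmxK sQ mulmxA. Qed.

Lemma psdmx_congr {m n : nat} (B : 'M[R]_(m, n)) (Q : 'M[R]_m) :
  psdmx Q -> psdmx (B^T *m Q *m B).
Proof.
move=> /psdmxP[sQ pQ]; apply/psdmxP; split=> [|v]; first exact: trmx_congr.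
by rewrite quad_congr.
Qed.

Lemma nonnegmx_quad {n : nat} (Q : 'M[R]_n) v :
  nonnegmx Q -> le_vec 0 v -> 0 <= quad Q v.
Proof.
move=> [_ Q0] v0; have {}v0 i : 0 <= v i 0 by have := v0 i; rewrite mxE.
rewrite /quad mxE; apply: sumr_ge0 => i _; apply: mulr_ge0 => //.
rewrite mxE; apply: sumr_ge0 => j _.
by rewrite mxE mulr_ge0.
Qed.

Lemma nonnegmx_congr {m n : nat} (B : 'M[R]_(m, n)) (Q : 'M[R]_m) :
  nonnegmx Q -> (forall i j, 0 <= B i j) -> nonnegmx (B^T *m Q *m B).
Proof.
move=> [/symmetricmxP sQ Q0] B0; split=> [|i j].
  by apply/symmetricmxP; exact: trmx_congr.
rewrite mxE; apply: sumr_ge0 => k _; apply: mulr_ge0 => //.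
rewrite mxE; apply: sumr_ge0 => l _.
by rewrite mxE mulr_ge0.
Qed.

(* The hyperplane of vectors [(0, y)] is reached by letting [r] grow in
   [(1, r y)] and [(1, - r y)]. *)
Lemma psdmx_qform_le {d : nat} (Q : 'M[R]_(1 + d)) (c : R) :
  Q^T = Q -> (forall x, qform Q x <= c) -> psdmx (c *: @Nmx R d - Q).
Proof.
move=> sQ Qc; apply/psdmxP; split=> [|v].
  rewrite linearB linearZ /= sQ; congr (_ *: _ - _).
  by rewrite /Nmx tr_block_mx !trmx0 trmx1.
have quadNmx (t : 'cV[R]_1) (y : 'cV[R]_d) :
    quad (Nmx R d) (col_mx t y) = t 0 0 ^+ 2.
  rewrite /quad /Nmx tr_col_mx mul_row_block mul_row_col.
  rewrite !mulmx0 !addr0 mul0mx addr0 mulmx1 mxE big_ord1 mxE expr2.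
  by rewrite !ord1.
rewrite quadD quadN quadZ -(vsubmxK v) quadNmx.
set t := usubmx v; set y := dsubmx v.
have [t0|t0] := eqVneq (t 0 0) 0; last first.
  (* By homogeneity, a vector with nonzero first coordinate reduces to one of the form [(1, x)]. *)
  have -> : col_mx t y = t 0 0 *: col_mx 1%:M ((t 0 0)^-1 *: y).
    rewrite scale_col_mx scalerA divff // scale1r; congr col_mx.
    by apply/matrixP => i j; rewrite !ord1 !mxE eqxx mulr1.
  rewrite quadZr; set q := quad _ _; have : q <= c by exact: Qc.
  have : 0 <= t 0 0 ^+ 2 by exact: sqr_ge0.
  by move: (_ ^+ 2) => a a0 qc; rewrite mulrC -mulrBr mulr_ge0 // subr_ge0.
have {t0}-> : t = 0 by apply/matrixP => i j; rewrite !ord1 t0 mxE.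
rewrite mxE expr0n /= mulr0 add0r oppr_ge0.
set e := quad _ _; set a := quad Q (col_mx 1%:M 0).
have ac : a <= c by exact: Qc.
have key r : a + r ^+ 2 * e <= c.
  have := quad_parallelogram Q (col_mx 1%:M 0) (r *: col_mx 0 y).
  rewrite quadZr -/e -/a scale_col_mx scaler0 opp_col_mx !add_col_mx.
  rewrite oppr0 !addr0 !add0r.
  have := Qc (r *: y); have := Qc (- (r *: y)); rewrite /qform -!/(quad _ _).
  lra.
rewrite leNgt; apply/negP => e0.
(* If [e > 0], then [r = 1 + (c - a) / e] gives [r ^ 2 * e >= e + 2 * (c - a) > c - a], against
   [key]. *)
have := key (1 + (c - a) / e).
have : 0 <= (c - a) / e by rewrite divr_ge0 ?subr_ge0 // ltW.
have : (c - a) / e * e = c - a by rewrite divfK // gt_eqF.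
by move: (_ / _) => r; nra.
Qed.

End Quadratic.

(** * Fixed points and limits in the coordinatewise order *)

Section Order.
Context {R : realType} {n : nat}.

Lemma le_vecE (u v : 'cV[R]_n) : le_vec (vecE u) (vecE v) <-> le_vec u v.
Proof. by split=> uv l; have := uv l; rewrite !mxE lee_fin. Qed.

Lemma le_vec_trans {disp} {T : porderType disp} (v u w : 'cV[T]_n) :
  le_vec u v -> le_vec v w -> le_vec u w.
Proof. by move=> uv vw l; exact: le_trans (uv l) (vw l). Qed.

Lemma le_vec_anti {disp} {T : porderType disp} (u v : 'cV[T]_n) :
  le_vec u v -> le_vec v u -> u = v.
Proof.
by move=> uv vu; apply/colP => l; apply/le_anti; rewrite uv vu.
Qed.

(** Knaster-Tarski: the coordinatewise infimum [u] of the real vectors [v] with [F v <= v] is a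
    fixed point. The bound [b] makes this infimum real; [b] and [w] make [F u] finite. *)
Lemma fixpoint_le_vec (F : 'cV[R]_n -> 'cV[\bar R]_n) (b w : 'cV[R]_n) :
  (forall u v, le_vec u v -> le_vec (F u) (F v)) ->
  (forall v, le_vec (vecE b) (F v)) -> le_vec (F w) (vecE w) ->
  exists2 u, F u = vecE u & le_vec u w.
Proof.
move=> Fmono bF Fw; pose A := [set v | le_vec (F v) (vecE v)].
have Ab v : A v -> le_vec b v.
  by move=> Av; apply/le_vecE; exact: le_vec_trans (bF v) Av.
pose u : 'cV[R]_n := \col_l inf [set v l 0 | v in A].
have uA v : A v -> le_vec u v.
  move=> Av l; rewrite mxE; apply: ge_inf; last by exists v.
  by exists (b l 0) => _ [z /Ab bz <-]; exact: bz.
pose v := map_mx fine (F u).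
have FuA z : A z -> le_vec (F u) (vecE z).
  by move=> Az; exact: le_vec_trans (Fmono _ _ (uA _ Az)) Az.
have Fuv : F u = vecE v.
  apply/colP => l; rewrite !mxE fineK // fin_numElt.
  have := bF u l; have := FuA w Fw l; rewrite !mxE => uw bu.
  by rewrite (lt_le_trans _ bu) ?ltNyr // (le_lt_trans uw) ?ltry.
have vu : le_vec v u.
  move=> l; rewrite [u l 0]mxE; apply: lb_le_inf; first by exists (w l 0), w.
  move=> _ [z Az <-]; move: (FuA z Az); rewrite Fuv => /le_vecE; exact.
have uv : u = v.
  (* Since [v = F u <= u], monotonicity gives [F v <= F u = v], so [v] belongs to [A]. *)
  by apply/le_vec_anti => //; apply: uA; rewrite /A /= -Fuv; exact: Fmono.
by exists u; [rewrite {2}uv | exact: uA].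
Qed.

Lemma cvg_mx_coord (u : nat -> 'cV[R]_n) (x : 'cV[R]_n) :
  (forall l, (fun k => u k l 0) @ \oo --> x l 0) -> u @ \oo --> x.
Proof.
move=> ux B [P xP PB]; rewrite nbhs_simpl /=.
have : \forall k \near \oo, forall i, P i 0 (u k i 0).
  by apply: filter_forall => i; apply: ux; exact: xP.
by apply: filterS => k Pk; apply: PB => i j; rewrite (ord1 j).
Qed.

Lemma nonincreasing_vec_cvg (u : nat -> 'cV[R]_n) (b : 'cV[R]_n) :
  (forall k, le_vec (u k.+1) (u k)) -> (forall k, le_vec b (u k)) ->
  exists x : 'cV[R]_n,
    [/\ u @ \oo --> x, forall l, (fun k => u k l 0) @ \oo --> x l 0 &
        forall k, le_vec x (u k)].
Proof.
move=> udec bu.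
have mono l : nonincreasing_seq (fun k => u k l 0).
  by apply/nonincreasing_seqP => k; exact: udec.
have cv l : cvgn (fun k => u k l 0).
  apply: nonincreasing_is_cvgn => //.
  by exists (b l 0) => _ [k _ <-]; exact: bu.
pose x : 'cV[R]_n := \col_l limn (fun k => u k l 0).
have ux l : (fun k => u k l 0) @ \oo --> x l 0 by rewrite mxE; exact: cv.
exists x; split => //; first exact: cvg_mx_coord.
by move=> k l; rewrite mxE; exact: (nonincreasing_cvgn_ge (mono l)).
Qed.

End Order.

(** * Matrices of the quadratic functions and of the polyhedra *)

Section Iteration.
Context {R : realType} {d : nat} {I : finType} {S : pwa R d I}.
Variable s : psd_point S.

Definition dot (lam omega : 'cV[R]_(d + 1)) : R :=
  \sum_k lam k 0 * omega k 0.

Lemma dot_le lam u v : le_vec 0 lam -> le_vec u v -> dot lam u <= dot lam v.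
Proof.
move=> lam0 uv; apply: ler_sum => k _; apply: ler_wpM2l; last exact: uv.
by have := lam0 k; rewrite mxE.
Qed.

Lemma trmx_Mmx A (b : 'cV[R]_d) c : A^T = A -> (Mmx A b c)^T = Mmx A b c.
Proof. by move=> sA; rewrite /Mmx tr_block_mx trmxK sA tr_scalar_mx. Qed.

(** Splits off the constant term, so that [alpha] and [beta] enter the constraints as multiples of
    [Nmx]. *)
Lemma MmxE A (b : 'cV[R]_d) c : Mmx A b c = Mmx A b 0 + c *: Nmx R d.
Proof.
rewrite /Mmx /Nmx scale_block_mx add_block_mx !scaler0 !addr0 raddf0 add0r.
by rewrite scale_scalar_mx mulr1.
Qed.

Lemma qform_Mmx A (b : 'cV[R]_d) c x :
  qform (Mmx A b c) x = c + (x^T *m b) 0 0 + (x^T *m A *m x) 0 0.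
Proof.
have xb : b^T *m x = x^T *m b.
  rewrite -[LHS]trmxK trmx_mul trmxK.
  by apply/matrixP => i j; rewrite !ord1 mxE.
rewrite /qform /Mmx tr_col_mx mul_row_block mul_row_col trmx1 !mul1mx.
rewrite mulmx1 [(_ *: b)^T]linearZ /= mulmxDl -scalemxAl xb -scalemxAr.
by move: (x^T *m b) (x^T *m A *m x) => B C; rewrite !mxE eqxx mulr1n; field.
Qed.

Lemma psdmx1 n : psdmx (1%:M : 'M[R]_n).
Proof.
apply/psdmxP; split=> [|v]; first exact: trmx1.
rewrite /quad mulmx1 mxE; apply: sumr_ge0 => i _.
by rewrite mxE -expr2 sqr_ge0.
Qed.

(** The form [|x|^2 - x_k^2] is the squared norm of [P x], where [P] is the orthogonal projection
    that kills the [k]-th coordinate. *)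
Lemma psdmx_Mmx1B (k : 'I_d) : psdmx (Mmx 1%:M 0 0 - Mk R k).
Proof.
pose P : 'M[R]_d := 1%:M - delta_mx k k.
have sP : P^T = P by rewrite linearB /= trmx1 trmx_delta.
have PP : P *m P = P.
  rewrite /P mulmxBr mulmx1 mulmxBl mul1mx mul_delta_mx_cond eqxx mulr1n.
  by rewrite subrr subr0.
pose B : 'M[R]_(1 + d) := block_mx 0 0 0 P.
have -> : Mmx 1%:M 0 0 - Mk R k = B^T *m 1%:M *m B.
  rewrite mulmx1 /Mk /Mmx opp_block_mx add_block_mx /B tr_block_mx sP.
  rewrite mulmx_block !trmx0 !(mul0mx, mulmx0) !addr0 add0r PP.
  by rewrite !subrr.
by apply: psdmx_congr; exact: psdmx1.
Qed.

Lemma Fmx_Nmx i : (Fmx S i)^T *m Nmx R d *m Fmx S i = Nmx R d.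
Proof.
rewrite /Fmx /Nmx tr_block_mx !mulmx_block !trmx0 trmx1.
by rewrite !(mul0mx, mulmx0, mul1mx, mulmx1, addr0).
Qed.

Lemma Hbar_ge0 n (T : 'M[R]_(n, d)) (c : 'cV[R]_n) (y : 'cV[R]_d) :
  (forall l, (T *m y) l 0 <= c l 0) -> le_vec 0 (Hbar T c *m col_mx 1%:M y).
Proof.
move=> Tc; rewrite /Hbar mul_block_col !mulmx1 mul0mx addr0 mulNmx => l.
rewrite !mxE; case: fintype.splitP => k _; first by rewrite ord1 mxE ler01.
by have := Tc k; move: (T *m y) => v; rewrite !mxE subr_ge0.
Qed.

Lemma Tmx_le_cvec (X : polyhedron R d) y :
  Defs.pset X y -> forall l, (Tmx X *m y) l 0 <= cvec X l 0.
Proof.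
move=> [Xs Xw] l; rewrite /Tmx /cvec mul_col_mx !mxE.
by case: fintype.splitP => k _; [apply: ltW; exact: Xs|exact: Xw].
Qed.

Lemma Ei0_ge0 i y : Defs.pset (region S i) y -> Defs.pset (init S) y ->
  le_vec 0 (Ei0 S i *m col_mx 1%:M y).
Proof.
move=> yi y0; apply: Hbar_ge0 => l; rewrite mul_col_mx !mxE.
by case: fintype.splitP => k _; exact: Tmx_le_cvec.
Qed.

(** Picks from the rows of [Eij] the leading one and those coming from the region [j]. *)
Definition row_selection i j : 'M[R]_(ni S j, nij S i j) :=
  block_mx 1%:M 0 0 (row_mx 0 1%:M).

Lemma row_selection_ge0 i j a b : 0 <= row_selection i j a b.
Proof.
rewrite !mxE; case: fintype.splitP => p _; rewrite mxE;
  case: fintype.splitP => q _; rewrite !mxE ?ler0n //.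
by case: fintype.splitP => r _; rewrite !mxE ?ler0n.
Qed.

(** The constraints of region [j] at [f^i x] are among the rows of [Eij]. Multipliers of (a) at [j]
    can thus be carried over to the pair [(i, j)]. *)
Lemma Ei_Fmx i j : Ei S j *m Fmx S i = row_selection i j *m Eij S i j.
Proof.
rewrite /Ei /Fmx /row_selection /Eij /Hbar !mulmx_block.
rewrite !(mul0mx, mulmx0, mul1mx, mulmx1, addr0, add0r).
by rewrite !mulNmx mulmxN !mul_row_col !mul0mx !mul1mx !add0r.
Qed.

(** * Monotonicity and upper semicontinuity of the relaxed functional *)

Lemma FRij_le i j l lam Y Z omega eta :
  le_vec 0 lam -> nonnegmx Y -> psdmx Z ->
  psdmx ((eta - dot lam omega) *: Nmx R d - Phi s (i:=i) (j:=j) l lam Y Z) ->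
  (FRij s i j l omega <= eta%:E)%E.
Proof.
by move=> ? ? ? ?; apply: ereal_inf_lbound; exists eta => //; exists lam, Y, Z.
Qed.

(* A feasible point at [v] remains feasible at [u] after shifting [eta]:
   [FRij] is an infimum of affine functions with nonnegative slopes. *)
Lemma FRij_lt_affine i j l (v : 'cV[R]_(d + 1)) x :
  (FRij s i j l v < x)%E -> exists lam eta,
  [/\ le_vec 0 lam, (eta%:E < x)%E &
      forall u, FRij s i j l u <= (eta + (dot lam u - dot lam v))%:E]%E.
Proof.
move=> /ereal_inf_lt[_ [eta [lam [Y [Z [lam0 Y0 Z0 H]]]] <-] etax].
exists lam, eta; split => // u; apply: (FRij_le lam0 Y0 Z0).
by rewrite -/(dot _ _) in H; rewrite addrA addrAC addrK.
Qed.

Lemma FRij_mono i j l u v :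
  le_vec u v -> (FRij s i j l u <= FRij s i j l v)%E.
Proof.
move=> uv; rewrite leNgt; apply/negP => /FRij_lt_affine.
move=> [lam [eta [lam0 etau /(_ u)]]].
apply/negP; rewrite -ltNge (le_lt_trans _ etau) // lee_fin gerDl subr_le0.
exact: dot_le.
Qed.

(** One affine majorant whose value at [v] is below [x] stays below [x] along the sequence, by
    continuity. *)
Lemma FRij_usc i j l (u : nat -> 'cV[R]_(d + 1)) (v : 'cV[R]_(d + 1)) x :
  (forall l, (fun k => u k l 0) @ \oo --> v l 0) ->
  (FRij s i j l v < x)%E ->
  \forall k \near \oo, (FRij s i j l (u k) < x)%E.
Proof.
move=> uv /FRij_lt_affine[lam [eta [_ etax ule]]].
have cv : (fun k => eta + (dot lam (u k) - dot lam v)) @ \oo --> eta.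
  rewrite -[X in _ --> X]addr0 -[X in _ --> _ + X](subrr (dot lam v)).
  apply: cvgD; first exact: cvg_cst.
  apply: cvgB; last exact: cvg_cst.
  apply: cvg_big => [|m _]; first exact: add_continuous.
  apply: cvgM; [exact: cvg_cst|exact: uv].
(* As [x] may be [+oo], a real level above [eta] is inserted. *)
have [r [etar rx]] : exists r, eta < r /\ (r%:E <= x)%E.
  case: x etax => [x| |] //=; last first.
    by exists (eta + 1); rewrite ltrDl ltr01 leey.
  by rewrite lte_fin; exists x.
have : \forall k \near \oo, eta + (dot lam (u k) - dot lam v) < r.
  exact: cvgr_lt cv _ etar.
apply: filterS => k kr.
by apply: (le_lt_trans (ule _)); apply: lt_le_trans rx; rewrite lte_fin.
Qed.

Lemma Flam_mono i j l lam u v : le_vec 0 lam -> le_vec u v ->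
  (Flam s i j l lam u <= Flam s i j l lam v)%E.
Proof.
move=> lam0 uv; rewrite /Flam leeD2r // lee_fin; exact: dot_le.
Qed.

Lemma sup_Sw_le (F : I -> I -> \bar R) x :
  (forall i j, Sw S i j -> (F i j <= x)%E) -> (sup_Sw S F <= x)%E.
Proof. by move=> H; apply: ge_ereal_sup => _ [ij /H ? <-]. Qed.

Lemma le_sup_Sw (F : I -> I -> \bar R) i j :
  Sw S i j -> (F i j <= sup_Sw S F)%E.
Proof. by move=> H; apply: ereal_sup_ubound; exists (i, j). Qed.

Lemma sup_Sw_mono (F G : I -> I -> \bar R) :
  (forall i j, Sw S i j -> (F i j <= G i j)%E) -> (sup_Sw S F <= sup_Sw S G)%E.
Proof.
move=> FG; apply: sup_Sw_le => i j ij.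
exact: le_trans (FG _ _ ij) (le_sup_Sw _ ij).
Qed.

Lemma FR_mono u v : le_vec u v -> le_vec (FR s u) (FR s v).
Proof.
move=> uv l; rewrite !mxE ge_max !le_max lexx orbT andbT.
by rewrite sup_Sw_mono // => i j _; exact: FRij_mono.
Qed.

Lemma Fpol_mono pi u v :
  (forall i j, Sw S i j -> forall l, le_vec 0 (pi i j l)) ->
  le_vec u v -> le_vec (Fpol s pi u) (Fpol s pi v).
Proof.
move=> pi0 uv l; rewrite !mxE ge_max !le_max lexx orbT andbT.
by rewrite sup_Sw_mono // => i j ij; apply: Flam_mono => //; exact: pi0.
Qed.

Lemma X0bound_le_Fpol pi v : le_vec (X0bound s) (Fpol s pi v).
Proof. by move=> l; rewrite [leRHS]mxE le_max lexx orbT. Qed.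

Lemma X0bound_le_FR v : le_vec (X0bound s) (FR s v).
Proof. by move=> l; rewrite [leRHS]mxE le_max lexx orbT. Qed.

Lemma Fpol_policy_at w pi : policy_at s w pi -> Fpol s pi w = FR s w.
Proof.
move=> piw; apply/colP => l; rewrite !mxE; congr maxe.
apply/eqP; rewrite eq_le; apply/andP; split; apply: sup_Sw_mono => i j ij;
by have [_ ->] := piw i j ij l.
Qed.

(** Only finitely many pairs are involved, so semicontinuity of each [FRij] holds for all of them
    eventually; the part [X0bound] is constant. *)
Lemma FR_usc (u : nat -> 'cV[R]_(d + 1)) (v : 'cV[R]_(d + 1)) l
    (x : R) :
  (forall l, (fun k => u k l 0) @ \oo --> v l 0) -> (FR s v l 0%R < x%:E)%E ->
  \forall k \near \oo, (FR s (u k) l 0%R < x%:E)%E.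
Proof.
move=> uv vx.
(* The intermediate [y] keeps the inequality strict after passing to the supremum. *)
have [y [vy yx]] : exists y : R, (FR s v l 0%R < y%:E)%E /\ y < x.
  case: (FR s v l 0%R) vx => [r| |] //; rewrite ?lte_fin => rx.
    by exists ((r + x) / 2); rewrite lte_fin; lra.
  by exists (x - 1); rewrite ltNyr; split=> //; lra.
have : \forall k \near \oo, forall ij : I * I, Sw S ij.1 ij.2 ->
    (FRij s ij.1 ij.2 l (u k) < y%:E)%E.
  apply: filter_forall => -[i j] /=.
  have [ij|] := pselect (Sw S i j); last by move=> nij; apply: nearW => k /nij.
  suff : \forall k \near \oo, (FRij s i j l (u k) < y%:E)%E.
    by apply: filterS => k.
  apply: FRij_usc uv _; apply: le_lt_trans vy.
  by rewrite mxE le_max (le_sup_Sw (fun i j => FRij s i j l v)).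
apply: filterS => k uy; apply: (@le_lt_trans _ _ y%:E); last by rewrite lte_fin.
rewrite mxE ge_max; apply/andP; split.
  by apply: sup_Sw_le => i j ij; apply/ltW; exact: (uy (i, j)).
by apply: le_trans (X0bound_le_FR v l) _; exact: ltW.
Qed.

(** * Comparison of the relaxed functional with the policies *)

Section Symmetric.
Hypothesis sP : forall i, (Pmx s i)^T = Pmx s i.

Lemma trmx_ML i : (ML s i)^T = ML s i. Proof. exact: trmx_Mmx. Qed.

(** Supplies the symmetry that [psdmx_qform_le] asks of [Phi]. *)
Lemma trmx_Phi i j l lam Y Z : nonnegmx Y -> psdmx Z ->
  (Phi s (i:=i) (j:=j) l lam Y Z)^T = Phi s l lam Y Z.
Proof.
move=> [/symmetricmxP sY _] [/symmetricmxP sZ _].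
have sk (k : 'I_d) : (Mk R k)^T = Mk R k.
  by rewrite /Mk trmx_Mmx ?trmx_delta.
have trD n (A B : 'M[R]_n) : A^T = A -> B^T = B -> (A + B)^T = A + B.
  by move=> sA sB; rewrite linearD /= sA sB.
have trN n (A : 'M[R]_n) : A^T = A -> (- A)^T = - A.
  by move=> sA; rewrite linearN /= sA.
have trZ n a (A : 'M[R]_n) : A^T = A -> (a *: A)^T = a *: A.
  by move=> sA; rewrite linearZ /= sA.
apply: (trD); last by apply: trmx_congr; exact: trD.
apply: (trD); last by apply: (trN); apply: trZ; exact: trmx_ML.
apply: (trD).
  by apply: trmx_congr; case: fintype.split => ?; [exact: sk|exact: trmx_ML].
apply: (trN); elim/big_ind : _; first exact: trmx0.
  exact: trD.
by move=> m _; apply: trZ.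
Qed.

(** For fixed [lam], [Y], [Z], let [c] be the supremum of the quadratic function of [Phi]. If [c] is
    real, [eta = dot lam omega + c] is feasible for [FRij] by [psdmx_qform_le]. *)
Lemma FRij_le_Flam i j l lam omega :
  le_vec 0 lam -> (FRij s i j l omega <= Flam s i j l lam omega)%E.
Proof.
move=> lam0; rewrite /Flam -leeBlDl //.
apply: le_ereal_inf_tmp => _ [[Y Z] [/= Y0 Z0] <-].
rewrite EFinN leeBlDl //; set c := ereal_sup _.
have qc x : ((qform (Phi s l lam Y Z) x)%:E <= c)%E.
  by apply: ereal_sup_ubound; exists x.
(* The value at [0] excludes [c = -oo], and [c = +oo] makes the bound trivial. *)
case: c qc => [c| |] qc; last by have := qc 0.
  rewrite -EFinD; apply: (FRij_le lam0 Y0 Z0).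
  rewrite addrAC subrr add0r; apply: psdmx_qform_le; first exact: trmx_Phi.
  by move=> x; have := qc x; rewrite lee_fin.
by rewrite addey // leey.
Qed.

Lemma FR_le_Fpol pi v :
  (forall i j, Sw S i j -> forall l, le_vec 0 (pi i j l)) ->
  le_vec (FR s v) (Fpol s pi v).
Proof.
move=> pi0 l; rewrite !mxE ge_max !le_max lexx orbT andbT.
by rewrite sup_Sw_mono // => i j ij; apply: FRij_le_Flam; exact: pi0.
Qed.

End Symmetric.

(** * Bounds at the initial vector from feasibility of the semidefinite program *)

Definition last_unit : 'cV[R]_(d + 1) := col_mx 0 1%:M.

Lemma last_unit_ge0 : le_vec 0 last_unit.
Proof.
move=> l; rewrite !mxE; case: fintype.splitP => k _; rewrite !mxE //.
Qed.

Lemma dot_last_unit : dot last_unit (winit s) = alpha s.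
Proof.
rewrite /dot big_split_ord /= big_ord1 big1 ?add0r => [|k _].
  by rewrite !col_mxEd !mxE eqxx mul1r.
by rewrite col_mxEu mxE mul0r.
Qed.

Lemma Phi_last_unit i j l Y Z :
  Phi s (i:=i) (j:=j) l last_unit Y Z =
  (Fmx S i)^T *m (match fintype.split l with inl k => Mk R k | inr _ => ML s j end)
    *m Fmx S i - ML s i + (Eij S i j)^T *m (Y + Z) *m Eij S i j.
Proof.
rewrite /Phi big1 => [|m _]; last by rewrite col_mxEu mxE scale0r.
by rewrite subr0 col_mxEd mxE eqxx scale1r.
Qed.

Section Feasible.
Hypothesis fs : psd_feasible s.

(* Summing (a) at [j] composed with [f^i] and (b) at [(i, j)] bounds
   [|f^i x|^2], hence each square [(f^i x)_k^2], with [lambda] the last unit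
   vector. *)
Lemma FR_winit_le : (forall l, (X0bound s l 0%R <= (winit s l 0%R)%:E)%E) ->
  le_vec (FR s (winit s)) (vecE (winit s)).
Proof.
move=> X0 l; rewrite [vecE _ _ _]mxE mxE ge_max X0 andbT.
case: fs => -[_ _ _] [W0 U0 _] ha hb _.
apply: sup_Sw_le => i j ij.
have [Up0 Us0] := U0 i j ij; have [Wp0 Ws0] := W0 j.
have congrD m n (B : 'M[R]_(m, n)) (P Q : 'M[R]_m) :
    B^T *m (P + Q) *m B = B^T *m P *m B + B^T *m Q *m B.
  by rewrite mulmxDr mulmxDl.
have congrN m n (B : 'M[R]_(m, n)) (Q : 'M[R]_m) :
    B^T *m (- Q) *m B = - (B^T *m Q *m B).
  by rewrite mulmxN mulNmx.
have congrZ m n (B : 'M[R]_(m, n)) a (Q : 'M[R]_m) :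
    B^T *m (a *: Q) *m B = a *: (B^T *m Q *m B).
  by rewrite -scalemxAr -scalemxAl.
have {}hb := hb i j ij; rewrite -!/(ML s _) in hb.
rewrite -(splitK l); case: (fintype.split l) => k /=; last first.
  (* For the coordinate of [L], (b) is the required inequality, with [eta = alpha]. *)
  rewrite /winit col_mxEd mxE.
  apply: (FRij_le last_unit_ge0 Up0 Us0).
  rewrite dot_last_unit subrr scale0r sub0r Phi_last_unit.
  rewrite (unsplitK (inr k)).
  by rewrite opprD opprB.
rewrite /winit col_mxEu mxE.
pose K := row_selection i j.
(* The multipliers of (a) at [j] are pulled back by [K] and added to those of (b); [K] has
   nonnegative entries, which keeps the first sum entrywise nonnegative. *)
apply: (@FRij_le _ _ _ _ (Up s i j + K^T *m Wp s j *m K)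
  (Us s i j + K^T *m Ws s j *m K) _ _ last_unit_ge0).
- have [/symmetricmxP sK K0] :=
    nonnegmx_congr Wp0 (@row_selection_ge0 i j).
  have [/symmetricmxP sU U0'] := Up0.
  split=> [|a b]; last by rewrite mxE addr_ge0.
  by apply/symmetricmxP; rewrite linearD /= sK sU.
- by apply: psdmxD => //; exact: psdmx_congr.
rewrite dot_last_unit Phi_last_unit (unsplitK (inl k)).
(* The third summand passes from [|f^i x|^2] to the square of its [k]-th coordinate. *)
have := psdmxD hb (psdmxD (psdmx_congr (Fmx S i) (ha j))
  (psdmx_congr (Fmx S i) (psdmx_Mmx1B k))).
congr psdmx.
have EW (W : 'M[R]_(ni S j)) :
    (Fmx S i)^T *m ((Ei S j)^T *m W *m Ei S j) *m Fmx S i =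
    (Eij S i j)^T *m (K^T *m W *m K) *m Eij S i j.
  by rewrite !mulmxA -trmx_mul -!mulmxA Ei_Fmx trmx_mul !mulmxA.
rewrite MmxE (MmxE 1%:M) -/(ML s j).
rewrite !(congrD, congrN, congrZ) !EW Fmx_Nmx.
move: (Nmx R d) (ML s i) (_ *m ML s j *m _) (_ *m Mk R k *m _).
move=> N M1 M2 M3; move: (_ *m Mmx _ _ _ *m _).
move: (_ *m Up s i j *m _) (_ *m Us s i j *m _).
move: (_ *m (_ *m Wp s j *m _) *m _) (_ *m (_ *m Ws s j *m _) *m _).
by move=> M4 M5 M6 M7 M8; apply/matrixP => a b; rewrite !mxE; ring.
Qed.

(** At a point [y] of [X^i] and [X^0] the multiplier terms are nonnegative. Hence (c) gives
    [L^i y <= alpha], and (a) gives [|y|^2 <= L^i y - alpha + beta <= beta]. *)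
Lemma X0bound_le_winit :
  \bigcup_(i in [set: I]) Defs.pset (region S i) = setT ->
  le_vec (X0bound s) (vecE (winit s)).
Proof.
move=> cover; case: fs => -[a0 b0 sP] [W0 _ Z0] ha _ hc.
have main i y : Defs.pset (region S i) y -> Defs.pset (init S) y ->
    Lloc s i y <= alpha s /\ (y^T *m 1%:M *m y) 0 0 <= beta s.
  move=> yi y0; have ini : In S i by exists y.
  have [Zp0 Zs0] := Z0 i ini; have [Wp0 Ws0] := W0 i.
  set v : 'cV[R]_(1 + d) := col_mx 1%:M y.
  have E0 : le_vec 0 (Ei S i *m v) by apply: Hbar_ge0; exact: Tmx_le_cvec.
  have E00 : le_vec 0 (Ei0 S i *m v) by exact: Ei0_ge0.
  have /psdmxP[_ /(_ v)] := hc i ini.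
  have /psdmxP[_ /(_ v)] := ha i.
  rewrite !(quadD, quadN, quad_congr).
  have /psdmxP[_ /(_ (Ei0 S i *m v))] := Zs0.
  have /psdmxP[_ /(_ (Ei S i *m v))] := Ws0.
  have := nonnegmx_quad Zp0 E00; have := nonnegmx_quad Wp0 E0.
  have -> : quad (Mmx (Pmx s i) (2 *: qvec s i) (- alpha s)) v
          = Lloc s i y - alpha s.
    by rewrite [LHS]qform_Mmx /Lloc -scalemxAr [X in _ + X + _]mxE; ring.
  have -> : quad (Mmx 1%:M 0 (- beta s)) v
          = - beta s + (y^T *m 1%:M *m y) 0 0.
    by rewrite [LHS]qform_Mmx mulmx0 [X in _ + X + _]mxE addr0.
  by move=> ? ? ? ? ? ?; split; lra.
have cov y : exists i, Defs.pset (region S i) y.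
  have : (\bigcup_(i in [set: I]) Defs.pset (region S i)) y by rewrite cover.
  by case=> i _; exists i.
move=> l; rewrite !mxE; case: fintype.splitP => k _;
  apply: ge_ereal_sup => _ [y y0 <-].
  have [i yi] := cov y; have [_] := main i y yi y0.
  rewrite mulmx1 lee_fin mxE (bigD1 k) //= mxE -expr2 mxE; apply: le_trans.
  by rewrite lerDl; apply: sumr_ge0 => m _; rewrite mxE -expr2 sqr_ge0.
rewrite lee_fin mxE /L; case: pickP => [i /asboolP yi|no].
  by have [] := main i y yi y0.
(* The default value of [L] cannot occur, since the regions cover the space. *)
by have [i yi] := cov y; have := no i; rewrite asboolT.
Qed.

End Feasible.

(** A point of [X^0] excludes [-oo] and [v] excludes [+oo]. The real vector [b] serves as lower
    bound for the fixed points and for the iterates. *)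
Lemma X0bound_fin v :
  Defs.pset (init S) !=set0 -> le_vec (X0bound s) (vecE v) ->
  exists b, X0bound s = vecE b.
Proof.
move=> [y y0] Xv; exists (map_mx fine (X0bound s)); apply/colP => l.
rewrite [RHS]mxE [X in X%:E]mxE fineK // fin_numElt; have := Xv l.
rewrite [vecE _ _ _]mxE => /le_lt_trans -> //; rewrite ?ltry // andbT.
rewrite mxE; case: fintype.split => k.
  apply: (lt_le_trans (ltNyr (y k 0 ^+ 2))).
  by apply: ereal_sup_ubound; exists y.
by apply: (lt_le_trans (ltNyr (L s y))); apply: ereal_sup_ubound; exists y.
Qed.

End Iteration.

(** * Invariant of the iteration, decrease of the iterates and their limit *)

Theorem theorem2 (R : realType) (d : nat) (I : finType) (S : pwa R d I)
    (hS : pwa_wf S)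
    (s : psd_point S) (hs : psd_optimal s) (halpha : 0 < alpha s)
    (w : nat -> 'cV[R]_(d + 1)) (hw : policy_iteration s w) :
  [/\ forall l, le_vec (FR s (w l)) (vecE (w l)),
      (forall l, le_vec (w l.+1) (w l)) /\
      (forall l, Sset s (w l) ->
        (w l.+1 = w l /\ FR s (w l.+1) = vecE (w l.+1)) \/
        lt_vec (w l.+1) (w l)),
      forall l, le_vec (X0bound s) (vecE (w l)) /\ le_vec (w l) (w 0%N) &
      exists winf : 'cV[R]_(d + 1),
        [/\ w @ \oo --> winf,
            le_vec (FR s winf) (vecE winf) &
            (forall k, Sset s (w k)) -> FR s winf = vecE winf]].
Proof.
case: hS => cover _ X0ne _; case: hs => fs _; case: hw => w0 wstep wstop.
have sP i : (Pmx s i)^T = Pmx s i.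
  by case: fs => -[_ _ sP] _ _ _ _; apply/symmetricmxP; exact: sP.
have X0w : le_vec (X0bound s) (vecE (w 0%N)).
  by rewrite w0; exact: X0bound_le_winit.
have [b Xb] := X0bound_fin X0ne X0w.
have FR0 : le_vec (FR s (w 0%N)) (vecE (w 0%N)).
  rewrite w0; apply: FR_winit_le => // l; have := X0w l.
  by rewrite [vecE _ _ _]mxE w0.
have step l : le_vec (FR s (w l)) (vecE (w l)) ->
    le_vec (FR s (w l.+1)) (vecE (w l.+1)) /\ le_vec (w l.+1) (w l).
  move=> FRl; have [ct|nct] := pselect (pi_continues s (w l)); last first.
    by rewrite wstop //; split=> // k.
  have [pi piw [Fw wmin]] := wstep l ct.
  have pi0 i j : Sw S i j -> forall k, le_vec 0 (pi i j k).
    by move=> ij k; have [] := piw i j ij k.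
  split; first by rewrite -Fw; exact: FR_le_Fpol.
  (* The next iterate is the smallest fixed point, so one fixed point [u] below [w l] is enough. *)
  have [| | |u Fu uw] := @fixpoint_le_vec _ _ (Fpol s pi) b (w l).
  - by move=> u v; exact: Fpol_mono.
  - by rewrite -Xb => v; exact: X0bound_le_Fpol.
  - by rewrite (Fpol_policy_at piw).
  by apply: le_vec_trans uw; exact: wmin.
have FRle l : le_vec (FR s (w l)) (vecE (w l)).
  by elim: l => // l /step[].
have wdec l : le_vec (w l.+1) (w l) by have [] := step l (FRle l).
have wXb l : le_vec (X0bound s) (vecE (w l)).
  exact: le_vec_trans (X0bound_le_FR s (w l)) (FRle l).
have [x [cvx cvxl xw]] : exists x : 'cV[R]_(d + 1),
    [/\ w @ \oo --> x, forall l, (fun k => w k l 0) @ \oo --> x l 0 &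
        forall k, le_vec x (w k)].
  apply: (nonincreasing_vec_cvg (b := b)) => k; first exact: wdec.
  by apply/le_vecE; rewrite -Xb.
have FRx : le_vec (FR s x) (vecE x).
  have FRxw k : le_vec (FR s x) (vecE (w k)).
    exact: le_vec_trans (FR_mono s (xw k)) (FRle k).
  (* The inequality [FR x <= w k] passes to the limit when its left side is real; [+oo] is excluded
     by [k = 0]. *)
  move=> l; rewrite [vecE _ _ _]mxE; case E : (FR s x l 0%R) => [r| |];
    last by rewrite leNye.
    rewrite lee_fin; apply: (cvgr_to_ge (cvxl l)); apply: nearW => k.
    by have := FRxw k l; rewrite E [vecE _ _ _]mxE lee_fin.
  by have := FRxw 0%N l; rewrite E [vecE _ _ _]mxE.
split => //.
- split=> // l Sl; have [eqw|neqw] := pselect (w l.+1 = w l); last first.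
    by right; split.
  (* Otherwise the iteration continues at [w l], which is then a fixed point of [Fpol pi]; but
     [Fpol pi] and [FR] agree at [w l]. *)
  left; split=> //; rewrite eqw; apply: contrapT => FRn.
  have [pi piw [Fw _]] := wstep l (conj Sl FRn).
  by apply: FRn; rewrite -(Fpol_policy_at piw) -eqw.
- move=> l; split=> //; elim: l => [|l IH] //.
  exact: le_vec_trans (wdec l) IH.
exists x; split=> // Sall; apply: le_vec_anti => // l.
(* If [FR x] were below [x] at [l], so would be [FR (w N)] for some [N], against
   [x <= w (N + 1) <= FR (w N)]. *)
rewrite [vecE _ _ _]mxE leNgt; apply/negP => /(FR_usc cvxl) [N _ /(_ N)].
rewrite /= leqnn => /(_ isT); apply/negP; rewrite -leNgt.
have wFR : le_vec (vecE (w N.+1)) (FR s (w N)).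
  have [ct|nct] := pselect (pi_continues s (w N)).
    have [pi piw [Fw _]] := wstep N ct.
    rewrite -Fw -(Fpol_policy_at piw); apply: Fpol_mono => // i j ij k.
    by have [] := piw i j ij k.
  (* As [w N] lies in [Sset], the iteration can only have stopped at a fixed point of [FR]. *)
  rewrite wstop //; suff -> : FR s (w N) = vecE (w N) by [].
  by apply: contrapT => FRn; apply: nct.
apply: le_trans (wFR l); rewrite [vecE _ _ _]mxE lee_fin; exact: xw.
Qed.
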